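(* There is an absolute constant $c>0$ with the following property. Let $v\ge1$ and $\Delta\ge 0$ be integers and $0<\epsilon<1$, and set $K=\left\lfloor c\sqrt{\Delta}\ln\frac{v}{\epsilon}\right\rfloor$. Then there exists a function $\Phi=\Phi_{v,\Delta,\epsilon}$ of $K+1$ numbers, with nonzero values, such that for every claw-free graph $G$ with $v(G)=v$ vertices and largest vertex degree $\Delta(G)=\Delta$, the number $\Phi(i_0(G),i_1(G),\dots,i_K(G))$ approximates $I(G)$ within relative error $\epsilon$. In words: up to relative error $\epsilon$, the number $I(G)$ of a claw-free graph $G$ is determined by the numbers $i_k(G)$ with $k\le c\sqrt{\Delta(G)}\ln\frac{v(G)}{\epsilon}$.
   Context: Graphs are finite, undirected, without loops or multiple edges. An independent set is a set of vertices no two of which span an edge; $i_k(G)$ is the number of independent sets with exactly $k$ vertices (so $i_0(G)=1$) and $I(G)=i_0(G)+i_1(G)+\cdots$ is the total number of independent sets. A graph is claw-free if it has no induced subgraph consisting of a vertex adjacent to three other vertices that are pairwise non-adjacent. $v(G)$ is the number of vertices and $\Delta(G)$ the largest degree of a vertex. For nonzero complex numbers $a,b$, $b$ approximates $a$ within relative error $\epsilon$ if $a=e^{z}$, $b=e^{w}$ for some complex $z,w$ with $|z-w|\le\epsilon$. *)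

(* Defs.v *)
From HB Require Import structures.
From mathcomp Require Import all_boot all_order all_algebra complex.
From mathcomp Require Import reals sequences exp trigo.

Set Implicit Arguments.
Unset Strict Implicit.
Unset Printing Implicit Defensive.

Import Order.TTheory GRing.Theory Num.Theory.

Record sgraph := SGraph {
  vertex : finType;
  adj : rel vertex;
  adj_sym : symmetric adj;
  adj_irr : irreflexive adj
}.

Section Graph.
Variable G : sgraph.
Implicit Types (S : {set vertex G}) (x y : vertex G).

Definition num_vertices : nat := #|vertex G|.

Definition degree x : nat := #|[set y | adj x y]|.

Definition max_degree : nat := \max_(x : vertex G) degree x.

Definition independent S : bool :=
  [forall x in S, forall y in S, ~~ adj x y].

Definition num_indep_k (k : nat) : nat :=
  #|[set S : {set vertex G} | independent S & #|S| == k]|.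

Definition num_indep : nat := #|[set S : {set vertex G} | independent S]|.

(* The centre [x] differs from the [y]s because [adj] is irreflexive. *)
Definition claw_free : Prop :=
  ~ exists x y1 y2 y3 : vertex G,
      [/\ uniq [:: y1; y2; y3],
          [/\ adj x y1, adj x y2 & adj x y3] &
          [/\ ~~ adj y1 y2, ~~ adj y1 y3 & ~~ adj y2 y3]].

End Graph.

Local Open Scope ring_scope.
Local Open Scope complex_scope.

Definition cexp (R : realType) (z : R[i]) : R[i] :=
  (expR (complex.Re z) * cos (complex.Im z)) +i*
  (expR (complex.Re z) * sin (complex.Im z)).

(* The norm on [R[i]] takes its values in [R[i]], hence the cast of [eps].
   [cexp] never vanishes, so both [a] and [b] are automatically nonzero. *)
Definition approximates (R : realType) (eps : R) (b a : R[i]) : Prop :=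
  exists z w : R[i],
    [/\ a = cexp z, b = cexp w & `|z - w| <= eps%:C].

(* Main.v *)
Require Import Defs.
From mathcomp Require Import classical_sets.
From mathcomp Require Import all_boot all_order all_algebra complex.
From mathcomp Require Import reals sequences exp trigo.
From mathcomp Require Import boolp topology normedtype derive realfun.
From mathcomp Require Import ring lra.
Import Order.TTheory GRing.Theory Num.Theory.
Import numFieldNormedType.Exports.
Set Implicit Arguments.
Unset Strict Implicit.
Unset Printing Implicit Defensive.
Local Open Scope ring_scope.
Local Open Scope complex_scope.

(** Three facts give the theorem.  First, the independence polynomial of a
    claw-free graph has only real roots (Chudnovsky and Seymour): following
    Bencs, a Christoffel-Darboux identity writes
    [I(x) y I'(y) - x I'(x) I(y)] as a sum over connected vertex sets [S] of a
    weight times [I_{G - N[S]}(x) I_{G - N[S]}(y)]; in a claw-free graph [S]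
    induces a path or a cycle, so that at [y = conj x] the weight is [y - x]
    times a nonnegative number, and induction on the graph shows that [I] does
    not vanish off the real line.  Secondly, [I(-t) > 0] for
    [t <= 1 / (4 Delta)], so [I(X)] is a product of [v] factors [1 + a X] with
    [0 <= a <= 4 Delta].  Thirdly, on [[0, 4 Delta]] the function [ln (1 + a)]
    is approximated by its Chebyshev expansion of degree [K] with an error that
    decays like [exp (- K / (2 sqrt Delta))]; the sum over [a] of the expansion
    only involves power sums of order at most [K], which by Newton's identities
    are functions of [i_1, ..., i_K].  So any two graphs sharing these numbers
    have close values of [I], and [Phi] may return the value of any one of them. *)

(** * Real-rootedness *)

Section IndepSum.
Variable G : sgraph.
Local Notation V := (vertex G).
Implicit Types (A B P Q S T U : {set V}).

(** The independence polynomial of the subgraph induced on [U]. Keeping [U] as a subset lets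
    inductions stay within one graph, and the general semiring allows [x] to be ['X]. *)
Definition indep_sum (R : pzSemiRingType) U (x : R) : R :=
  \sum_(A : {set V} | (A \subset U) && independent A) x ^+ #|A|.

Lemma independentP A :
  reflect {in A &, forall u w, ~~ adj u w} (independent A).
Proof.
apply: (iffP forall_inP) => [h u w uA wA | h u uA].
  by have /forall_inP := h u uA; apply.
by apply/forall_inP => w wA; apply: h.
Qed.

Lemma independentS A B : A \subset B -> independent B -> independent A.
Proof.
move=> /subsetP sAB /independentP iB.
by apply/independentP => u w /sAB uB /sAB wB; apply: iB.
Qed.

(** Connectedness through cuts rather than paths: the form needed to grow a set one adjacent vertex
    at a time. *)
Definition connected S : bool :=
  (S != set0) && [forall T : {set V},
    [&& T \subset S, T != set0 & T != S] ==>
      [exists u in T, exists w in S :\: T, adj u w]].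

Lemma connectedP S : reflect
  (S != set0 /\ forall T, T \subset S -> T != set0 -> T != S ->
     exists u w, [/\ u \in T, w \in S :\: T & adj u w]) (connected S).
Proof.
apply: (iffP andP) => [[S0 /forallP h]|[S0 h]]; split=> // .
  move=> T sTS T0 TS; have := h T; rewrite sTS T0 TS /= => /exists_inP[u uT].
  by move=> /exists_inP[w wS uw]; exists u, w.
apply/forallP => T; apply/implyP => /and3P[sTS T0 TS].
have [u [w [uT wS uw]]] := h T sTS T0 TS.
by apply/exists_inP; exists u => //; apply/exists_inP; exists w.
Qed.

Lemma connected1 (u : V) : connected [set u].
Proof.
apply/connectedP; split; first by apply/set0Pn; exists u; rewrite set11.
by move=> T; rewrite subset1 => /orP[] /eqP->; rewrite eqxx.
Qed.

Definition separated S T : bool :=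
  [forall u in S, forall w in T, ~~ adj u w].

Lemma separatedP S T :
  reflect (forall u w, u \in S -> w \in T -> ~~ adj u w) (separated S T).
Proof.
apply: (iffP forall_inP) => [h u w uS wT | h u uS].
  by have /forall_inP := h u uS; apply.
by apply/forall_inP => w wT; apply: h.
Qed.

(** * Components of the symmetric difference of two independent sets *)

Definition symdiff A B := (A :\: B) :|: (B :\: A).

(** Separation is from the rest of [A :|: B], not just of the symmetric difference, so that the
    parts of [A] and [B] outside [S] also avoid the neighbours of [S]. *)
Definition component A B S : bool :=
  [&& connected S, S \subset symdiff A B & separated S ((A :|: B) :\: S)].

(** If [S] were not inside [T], connectedness of [S] would give an edge from [S :&: T] to [S :\: T],
    against the separation of [T]. *)
Lemma component_eq A B S T u :
  component A B S -> component A B T -> u \in S -> u \in T -> S = T.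
Proof.
suff sub S' T' : component A B S' -> component A B T' -> u \in S' ->
    u \in T' -> S' \subset T'.
  by move=> cS cT uS uT; apply/eqP; rewrite eqEsubset !sub.
case/and3P=> /connectedP[_ conS] sS _ /and3P[_ _ /separatedP sepT] uS uT.
have [/setIidPl//|neST] := eqVneq (S' :&: T') S'.
have [|a [b [/setIP[aS aT] /setDP[bS bST] ab]]] :=
    conS _ (subsetIl S' T') _ neST.
  by apply/set0Pn; exists u; rewrite inE uS.
have bT : b \notin T' by move: bST; rewrite inE bS.
suff bU : b \in (A :|: B) :\: T' by rewrite (negbTE (sepT a b aT bU)) in ab.
rewrite inE bT.
by move: (subsetP sS b bS); rewrite !inE => /orP[] /andP[_ ->]; rewrite ?orbT.
Qed.

(** A minimal set that contains [u] and has no edge to the rest of the symmetric difference is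
    connected: a cut without edges would leave a smaller such set on the side of [u]. *)
Lemma component_ex A B u : independent A -> independent B ->
  u \in symdiff A B -> exists2 S, component A B S & u \in S.
Proof.
move=> /independentP iA /independentP iB uD.
pose D := symdiff A B.
pose p S := [&& u \in S, S \subset D & separated S (D :\: S)].
have pD : p D.
  by rewrite /p uD subxx; apply/separatedP => a b _; rewrite setDv inE.
have [S /minsetP[/and3P[uS sSD /separatedP sepS] minS] _] := minset_exists pD.
exists S => //; apply/and3P; split=> //; last first.
  apply/separatedP => a b aS /setDP[bAB bS]; apply/negP => ab.
  have [bD|bD] := boolP (b \in D).
    by rewrite (negbTE (sepS a b aS _)) // inE bS bD in ab.
  have aAB : a \in A :|: B.
    by have := subsetP sSD a aS; rewrite !inE => /orP[]/andP[_ ->]; rewrite ?orbT.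
  (* A vertex common to both independent sets has no neighbour in either. *)
  have [bA bB] : b \in A /\ b \in B.
    move: bD bAB; rewrite !inE.
    by case: (b \in A); case: (b \in B).
  by move: aAB; rewrite inE => /orP[aA|aB];
    [case/negP: (iA a b aA bA)|case/negP: (iB a b aB bB)].
apply/connectedP; split; first by apply/set0Pn; exists u.
move=> T sTS T0 TS.
have [/existsP[[a b] /= /and3P[aT bS ab]]|/existsPn h] :=
  boolP [exists ab : V * V, [&& ab.1 \in T, ab.2 \in S :\: T & adj ab.1 ab.2]].
  by exists a, b.
have {}h a b : a \in T -> b \in S -> b \notin T -> ~~ adj a b.
  by move=> aT bS bT; apply/negP => ab; have := h (a, b); rewrite /= inE aT bS bT ab.
exfalso; have [uT|uT] := boolP (u \in T).
  case/negP: TS; apply/eqP; apply: minS => //; apply/and3P; split=> //.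
    exact: subset_trans sSD.
  apply/separatedP => a b aT /setDP[bD bT].
  have aS := subsetP sTS a aT.
  have [bS|bS] := boolP (b \in S); first exact: h.
  by apply: sepS => //; rewrite inE bS.
have E : S :\: T = S.
  apply: minS; last exact: subsetDl.
  apply/and3P; split; first by rewrite inE uT.
    by apply: subset_trans sSD; apply: subsetDl.
  apply/separatedP => a b /setDP[aS aT] /setDP[bD]; rewrite inE negb_and negbK.
  have [bT _|bT /= bS] := boolP (b \in T).
    by rewrite adj_sym; apply: h.
  by apply: sepS => //; rewrite inE bS.
case/set0Pn: T0 => t tT; have := subsetP sTS t tT.
by rewrite -E inE tT.
Qed.

(** After exchanging the sums, each vertex of the symmetric difference is counted in exactly one
    component, and all other vertices have weight [f u = 0]. *)
Lemma sum_component (R : pzRingType) A B : independent A -> independent B ->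
  \sum_(S | component A B S) (#|B :&: S|%:R - #|A :&: S|%:R)
    = #|B|%:R - #|A|%:R :> R.
Proof.
move=> iA iB.
pose f u : R := (u \in B)%:R - (u \in A)%:R.
have cardE (X S : {set V}) : (#|X :&: S|%:R : R) = \sum_(u in S) (u \in X)%:R.
  rewrite -sum1_card natr_sum [RHS](bigID (mem X)) /= [X in _ + X]big1.
    rewrite addr0; apply: eq_big => [u|u]; first by rewrite inE andbC.
    by rewrite inE => /andP[->].
  by move=> u /andP[_ /negbTE->].
have -> : \sum_(S | component A B S) (#|B :&: S|%:R - #|A :&: S|%:R : R)
    = \sum_(S | component A B S) \sum_(u in S) f u.
  by apply: eq_bigr => S _; rewrite !cardE -sumrB.
rewrite (exchange_big_dep xpredT) //=.
have -> : #|B|%:R - #|A|%:R = \sum_u f u.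
  rewrite sumrB -[B in LHS]setIT -[A in LHS]setIT !cardE.
  by congr (_ - _); apply: eq_bigl => u; rewrite inE.
apply: eq_bigr => u _.
have [uD|uD] := boolP (u \in symdiff A B).
  have [S cS uS] := component_ex iA iB uD.
  rewrite (bigD1 S) /= ?cS // big1 ?addr0 // => T /andP[/andP[cT uT] /eqP[]].
  exact: component_eq cT cS uT uS.
rewrite big_pred0.
  by move: uD; rewrite /f !inE; case: (u \in A); case: (u \in B) => //=; rewrite ?subrr.
move=> S; apply/negP => /andP[/and3P[_ /subsetP sS _] /sS].
by rewrite (negbTE uD).
Qed.

Definition closed_nbhd S := S :|: [set w | [exists u in S, adj u w]].

Definition bipartition S P Q : bool :=
  [&& independent P, independent Q, P :&: Q == set0 & P :|: Q == S].

Lemma big_set_split (R : nmodType) S (c : pred {set V}) (F : {set V} -> R) :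
  \sum_(A | c A) F A =
  \sum_(P : {set V} | P \subset S) \sum_(A : {set V} | (A \subset ~: S) && c (P :|: A)) F (P :|: A).
Proof.
rewrite (partition_big (fun A => A :&: S) (fun P => P \subset S)) /=; last first.
  by move=> A _; apply: subsetIr.
apply: eq_bigr => P sPS.
rewrite (reindex_onto (fun A' => P :|: A') (fun A => A :\: S)) /=; last first.
  by move=> A /andP[_ /eqP<-]; rewrite setUC setUC setID.
apply: eq_bigl => A'.
have [sA|sA] := boolP (A' \subset ~: S).
  have dA : A' :&: S = set0 by apply/eqP; rewrite setI_eq0 disjoints_subset.
  rewrite setIUl dA setU0 (setIidPl sPS) eqxx andbT setDUl.
  have -> : P :\: S = set0 by apply/eqP; rewrite setD_eq0.
  have -> : A' :\: S = A' by apply/setDidPl; rewrite disjoints_subset.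
  by rewrite set0U eqxx andbT.
apply/negbTE; rewrite negb_and; apply/orP; right.
apply: contra sA => /eqP <-; rewrite setDE; exact: subsetIr.
Qed.

Lemma independentU P A :
  independent (P :|: A) = [&& independent P, independent A & separated P A].
Proof.
apply/idP/and3P => [i|[/independentP iP /independentP iA /separatedP s]].
  split; try by apply: independentS i; rewrite ?subsetUl ?subsetUr.
  move/independentP: i => i; apply/separatedP => u w uP wA.
  by apply: i; rewrite inE ?uP ?wA ?orbT.
apply/independentP => u w; rewrite !inE => /orP[uP|uA] /orP[wP|wA].
- exact: iP.
- exact: s.
- by rewrite adj_sym; apply: s.
- exact: iA.
Qed.

Lemma subset_nbhdC U S A : A \subset ~: S ->
  (A \subset U :\: closed_nbhd S) = (A \subset U) && separated S A.
Proof.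
move=> sA; apply/subsetP/andP => [h|[/subsetP sAU /separatedP s] w wA].
  split; first by apply/subsetP => w /h /setDP[].
  apply/separatedP => u w uS /h /setDP[_]; rewrite !inE negb_or => /andP[_].
  by move=> /exists_inPn /(_ u uS).
have wS : w \notin S by have := subsetP sA w wA; rewrite inE.
rewrite !inE (negbTE wS) sAU // andbT /=.
by apply/exists_inPn => u uS; apply: s.
Qed.

Lemma component_split U S P Q A B : connected S -> S \subset U ->
  P \subset S -> Q \subset S -> A \subset ~: S -> B \subset ~: S ->
  [&& P :|: A \subset U, independent (P :|: A), Q :|: B \subset U,
      independent (Q :|: B) & component (P :|: A) (Q :|: B) S] =
  [&& bipartition S P Q, A \subset U :\: closed_nbhd S, independent A,
      B \subset U :\: closed_nbhd S & independent B].
Proof.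
move=> cS sSU sP sQ sA sB; rewrite !subset_nbhdC // /component cS /=.
have notS (X : {set V}) w : X \subset ~: S -> w \in S -> w \notin X.
  by move=> sX wS; apply/negP => /(subsetP sX); rewrite inE wS.
have sPU := subset_trans sP sSU; have sQU := subset_trans sQ sSU.
rewrite !subUset sPU sQU /= !independentU /bipartition.
have -> : (S \subset symdiff (P :|: A) (Q :|: B))
    = (P :&: Q == set0) && (P :|: Q == S).
  apply/subsetP/andP => [h|[/eqP PQ0 /eqP PQS] w wS].
    split.
      apply/eqP/setP => w; rewrite !inE; apply/negP => /andP[wP wQ].
      by have := h w (subsetP sP w wP); rewrite !inE wP wQ.
    rewrite eqEsubset subUset sP sQ /=; apply/subsetP => w wS.
    have := h w wS; rewrite !inE (negbTE (notS _ _ sA wS)) (negbTE (notS _ _ sB wS)).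
    by rewrite !orbF => /orP[] /andP[_ ->]; rewrite ?orbT.
  have /setP/(_ w) := PQ0; have /setP/(_ w) := PQS.
  rewrite !inE wS (negbTE (notS _ _ sA wS)) (negbTE (notS _ _ sB wS)) !orbF.
  by case: (w \in P); case: (w \in Q).
have -> : separated S (((P :|: A) :|: (Q :|: B)) :\: S)
    = separated S A && separated S B.
  apply/separatedP/andP => [h|[/separatedP hA /separatedP hB] u w uS].
    by split; apply/separatedP => u w uS wX; apply: h => //; rewrite !inE wX ?orbT andbT;
      [have := subsetP sA w wX|have := subsetP sB w wX]; rewrite inE.
  rewrite !inE => /andP[wS].
  move=> /orP[/orP[/(subsetP sP)|wA]|/orP[/(subsetP sQ)|wB]]; rewrite ?(negbTE wS) //.
    exact: hA.
  exact: hB.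
have sepS (X Y : {set V}) : X \subset S -> separated S Y -> separated X Y.
  move=> /subsetP sX /separatedP h; apply/separatedP => u w /sX; exact: h.
have [hA|hA] := boolP (separated S A); last by rewrite !andbF.
have [hB|hB] := boolP (separated S B); last by rewrite !andbF.
rewrite (sepS P A) // (sepS Q B) // !andbT -!andbA.
by do !bool_congr.
Qed.

Definition bipart_weight (R : pzRingType) S (x y : R) : R :=
  \sum_(P : {set V}) \sum_(Q : {set V} | bipartition S P Q)
     (#|Q|%:R - #|P|%:R) * (x ^+ #|P| * y ^+ #|Q|).

(* In a pair [(A, B)] of independent sets the part of [A] and [B] inside a
   component [S] of their symmetric difference can be chosen independently of
   the part outside the closed neighbourhood of [S]. *)
Lemma christoffel_darboux (R : comPzRingType) U (x y : R) :
  \sum_(A : {set V} | (A \subset U) && independent A)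
   \sum_(B : {set V} | (B \subset U) && independent B)
     (#|B|%:R - #|A|%:R) * (x ^+ #|A| * y ^+ #|B|) =
  \sum_(S : {set V} | connected S && (S \subset U))
     bipart_weight S x y * (indep_sum (U :\: closed_nbhd S) x *
                            indep_sum (U :\: closed_nbhd S) y).
Proof.
pose t S A B := (#|B :&: S|%:R - #|A :&: S|%:R) * (x ^+ #|A| * y ^+ #|B|).
transitivity (\sum_(A : {set V} | (A \subset U) && independent A)
   \sum_(B : {set V} | (B \subset U) && independent B)
    \sum_(S | component A B S) t S A B).
  apply: eq_bigr => A /andP[_ iA]; apply: eq_bigr => B /andP[_ iB].
  by rewrite -(sum_component _ iA iB) big_distrl.
transitivity (\sum_(S : {set V} | connected S && (S \subset U))
   \sum_(A : {set V} | (A \subset U) && independent A)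
   \sum_(B : {set V} | [&& B \subset U, independent B & component A B S]) t S A B).
  rewrite [RHS]exchange_big; apply: eq_bigr => A /andP[sA iA].
  rewrite (exchange_big_dep (fun S => connected S && (S \subset U))) /=.
    by apply: eq_bigr => S _; apply: eq_bigl => B; rewrite andbA.
  move=> B S /andP[sB iB] /and3P[-> sS _]; apply: subset_trans sS _.
  by rewrite subUset !(subset_trans (subsetDl _ _)).
apply: eq_bigr => S /andP[cS sSU].
transitivity (\sum_(P : {set V} | P \subset S)
  \sum_(A : {set V} | (A \subset ~: S) && ((P :|: A \subset U) && independent (P :|: A)))
  \sum_(Q : {set V} | Q \subset S)
  \sum_(B : {set V} | (B \subset ~: S) && [&& Q :|: B \subset U, independent (Q :|: B)
       & component (P :|: A) (Q :|: B) S]) t S (P :|: A) (Q :|: B)).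
  rewrite (big_set_split S); apply: eq_bigr => P _; apply: eq_bigr => A _.
  by rewrite (big_set_split S).
rewrite /bipart_weight big_distrl [LHS]big_mkcond; apply: eq_bigr => P _ /=.
case: ifP => [sP|sP]; last first.
  rewrite big_pred0 ?mul0r // => Q; apply/negP => /and4P[_ _ _ /eqP E].
  by rewrite -E subsetUl in sP.
rewrite exchange_big big_distrl [LHS]big_mkcond [RHS]big_mkcond; apply: eq_bigr => Q _ /=.
case: ifP => [sQ|sQ]; last first.
  case: ifP => // /and4P[_ _ _ /eqP E].
  by rewrite -E subsetUr in sQ.
rewrite [LHS]pair_big_dep /=.
pose c (p : {set V} * {set V}) := [&& p.1 \subset U :\: closed_nbhd S,
  independent p.1, p.2 \subset U :\: closed_nbhd S & independent p.2].
have sC (A : {set V}) : A \subset U :\: closed_nbhd S -> A \subset ~: S.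
  move=> /subset_trans; apply; rewrite subDset; apply/subsetP => u _.
  by rewrite !inE; case: (u \in S); rewrite ?orbT.
transitivity (\sum_(p | bipartition S P Q && c p) t S (P :|: p.1) (Q :|: p.2)).
  apply: eq_bigl => -[A B]; rewrite /c /=.
  have [sA|sA] := boolP (A \subset ~: S); last first.
    by rewrite (contraNF (@sC A) sA) ?andbF.
  have [sB|sB] := boolP (B \subset ~: S); last first.
    by rewrite (contraNF (@sC B) sB) ?andbF.
  by rewrite /= -component_split // -?andbA.
have [bS|_] := boolP (bipartition S P Q); last exact: big_pred0.
rewrite /= /indep_sum big_distrlr /= [in RHS]pair_big /= big_distrr /=.
apply: eq_big => [[A B]|[A B] /and4P[/= /sC sA _ /sC sB _]].
  by rewrite /c /= !andbA.
have dS (X Y : {set V}) : X \subset S -> Y \subset ~: S ->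
    ((X :|: Y) :&: S = X) * (#|X :|: Y| = #|X| + #|Y|)%N.
  move=> sX sY.
  have dY : Y :&: S = set0 by apply/eqP; rewrite setI_eq0 disjoints_subset.
  split; first by rewrite setIUl dY setU0 (setIidPl sX).
  rewrite cardsU [X :&: Y](_ : _ = set0) ?cards0 ?subn0 //.
  by apply/eqP; rewrite -subset0 -dY setIC setIS.
rewrite /t !dS // !exprD -!mulrA; congr (_ * (_ * _)).
by rewrite !mulrA; congr (_ * _); rewrite mulrC.
Qed.

(** The sums weighted by [#|B|] are [y I'(y)] and [x I'(x)]; in this form the double sum visibly
    vanishes at [x] and [y] when both are zeros of [I]. *)
Lemma indep_sum_deriv (R : comPzRingType) U (x y : R) :
  \sum_(A : {set V} | (A \subset U) && independent A)
   \sum_(B : {set V} | (B \subset U) && independent B)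
     (#|B|%:R - #|A|%:R) * (x ^+ #|A| * y ^+ #|B|) =
  indep_sum U x * \sum_(B : {set V} | (B \subset U) && independent B) #|B|%:R * y ^+ #|B|
  - (\sum_(B : {set V} | (B \subset U) && independent B) #|B|%:R * x ^+ #|B|) * indep_sum U y.
Proof.
rewrite /indep_sum !big_distrlr -sumrB; apply: eq_bigr => A _ /=.
rewrite -sumrB; apply: eq_bigr => B _.
by rewrite mulrBl mulrCA !mulrA.
Qed.

(** * Bipartitions of connected sets in claw-free graphs *)

Lemma card_adj_le2 : claw_free G -> forall u A, independent A ->
  (#|[set w in A | adj u w]| <= 2)%N.
Proof.
move=> cf u A /independentP iA; rewrite leqNgt; apply/negP.
case/card_gt2P => [y1 [y2 [y3 [[]]]]]; rewrite !inE.
move=> /andP[A1 u1] /andP[A2 u2] /andP[A3 u3] [n12 n23 n31]; apply: cf.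
exists u, y1, y2, y3; split; last by split; apply: iA.
  by rewrite /= !inE negb_or n12 n23 eq_sym n31.
by [].
Qed.

Definition cross_edges P Q : {set V * V} :=
  [set p | [&& p.1 \in P, p.2 \in Q & adj p.1 p.2]].

(** The set is grown one vertex at a time. Each new vertex brings an edge, which cannot lie within
    [P] or within [Q] and is recorded with its end in [P] first. *)
Lemma connected_card_edges S P Q : connected S -> bipartition S P Q ->
  (#|S| <= #|cross_edges P Q|.+1)%N.
Proof.
move=> /connectedP[S0 conS] /and4P[/independentP iP /independentP iQ _ /eqP PQ].
suff grow n : (n < #|S|)%N -> exists T : {set V},
    [/\ T \subset S, #|T| = n.+1 & (n <= #|cross_edges (P :&: T) (Q :&: T)|)%N].
  have cS : (0 < #|S|)%N by rewrite card_gt0.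
  have [|T [sTS cT leE]] := grow #|S|.-1; first by rewrite prednK.
  rewrite -(prednK cS) ltnS (leq_trans leE) // subset_leq_card //.
  by apply/subsetP => p; rewrite !inE => /and3P[/andP[-> _] /andP[-> _] ->].
elim: n => [|n IH] ltn.
  case/set0Pn: S0 => u uS; exists [set u]; split; rewrite ?cards1 //.
  by rewrite sub1set.
have [T [sTS cT leE]] := IH (ltnW ltn).
have [||u [w [uT /setDP[wS wT] uw]]] := conS T sTS.
- by rewrite -card_gt0 cT.
- by apply: contraTneq ltn => <-; rewrite cT ltnn.
exists (w |: T); split.
- by rewrite subUset sub1set wS.
- by rewrite cardsU1 wT cT.
apply: (leq_ltn_trans leE); apply: proper_card; apply/properP; split.
  apply/subsetP => p; rewrite !inE.
  by move=> /and3P[/andP[-> ->] /andP[-> ->] ->]; rewrite !orbT.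
have uS := subsetP sTS u uT.
move: (uS) (wS); rewrite -PQ !inE.
case/orP=> [uP|uQ] /orP[wP|wQ].
- by have := iP _ _ uP wP; rewrite uw.
- by exists (u, w); rewrite !inE /= ?uP ?wQ ?uw ?uT ?eqxx ?orbT // (negbTE wT) ?andbF.
- by exists (w, u); rewrite !inE /= ?uQ ?wP ?uT ?eqxx ?orbT /=
    ?[adj w u]adj_sym // (negbTE wT) ?andbF.
- by have := iQ _ _ uQ wQ; rewrite uw.
Qed.

Lemma card_cross_edges P Q : claw_free G -> independent Q ->
  (#|cross_edges P Q| <= 2 * #|P|)%N.
Proof.
move=> cf iQ.
rewrite -sum1_card (partition_big (fun p => p.1) (mem P)) /=; last first.
  by move=> p; rewrite inE => /and3P[].
rewrite mulnC -sum_nat_const; apply: leq_sum => u uP.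
apply: leq_trans (card_adj_le2 cf u iQ).
have inj : injective (fun w : V => (u, w)) by move=> a b [].
rewrite sum1_card -(card_imset (mem [set w in Q | adj u w]) inj).
apply: subset_leq_card; apply/subsetP => -[a b]; rewrite unfold_in inE /=.
case/andP=> [/and3P[/= aP bQ ab] /eqP ea]; rewrite ea in ab *.
by apply: imset_f; rewrite inE bQ.
Qed.

Lemma bipartition_sym S P Q : bipartition S P Q = bipartition S Q P.
Proof.
by rewrite /bipartition setIC setUC; case: (independent P); case: (independent Q).
Qed.

(* A connected [S] spans at least [#|P| + #|Q| - 1] edges, and claw-freeness
   allows at most two of them at each vertex of [P]. *)
Lemma bipartition_card S P Q : claw_free G -> connected S ->
  bipartition S P Q -> (#|Q| <= #|P|.+1)%N.
Proof.
move=> cf cS bS; have := connected_card_edges cS bS.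
case/and4P: bS => _ iQ /eqP PQ0 /eqP <-.
rewrite cardsU PQ0 cards0 subn0 => h.
have := leq_trans h (card_cross_edges P cf iQ : (_.+1 <= (2 * _).+1)%N).
by rewrite mul2n -addnn -addnS leq_add2l.
Qed.

(** The cofactor of [y - x] in [bipart_weight S x y], with [z = x * y]; its terms are nonnegative
    for [z >= 0]. *)
Definition near_balanced_sum (R : pzRingType) S (z : R) : R :=
  \sum_(P : {set V}) \sum_(Q : {set V} | bipartition S P Q)
     (if #|Q| == #|P|.+1 then z ^+ #|P| else 0).

(** The sizes of [P] and [Q] differ by at most one. Balanced pairs contribute zero; a pair with
    [#|Q| = #|P| + 1] contributes [y (x y) ^ #|P|], and its swap contributes [- x (x y) ^ #|P|]. *)
Lemma bipart_weightE (R : comPzRingType) S (x y : R) :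
  claw_free G -> connected S ->
  bipart_weight S x y = (y - x) * near_balanced_sum S (x * y).
Proof.
move=> cf cS; rewrite /near_balanced_sum.
pose h a b : R := if b == a.+1 then (x * y) ^+ a else 0.
pose f a b : R := x ^+ a * y ^+ b.
have wE P Q : bipartition S P Q -> (#|Q|%:R - #|P|%:R) * f #|P| #|Q| =
   y * h #|P| #|Q| - x * h #|Q| #|P|.
  move=> b; have := bipartition_card cf cS b.
  have := b; rewrite bipartition_sym => /(bipartition_card cf cS).
  rewrite /f /h; move: #|P| #|Q| => p q.
  rewrite leq_eqVlt => /orP[/eqP->|].
    by rewrite eqxx ltn_eqF // mulr0 sub0r mulrSr opprD addrA subrr sub0r exprS exprMn mulN1r mulrA.
  rewrite ltnS => pq; rewrite leq_eqVlt => /orP[/eqP->|].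
    rewrite eqxx ltn_eqF // mulr0 subr0 mulrSr addrAC subrr add0r mul1r exprS exprMn.
    by rewrite mulrCA.
  rewrite ltnS => qp; have -> : p = q by apply/eqP; rewrite eqn_leq pq.
  by rewrite subrr mul0r ltn_eqF // !mulr0 subrr.
rewrite /bipart_weight mulrBl.
under eq_bigr => P _ do under eq_bigr => Q b do rewrite wE //.
under eq_bigr => P _ do rewrite sumrB.
rewrite sumrB !big_distrr /=; congr (_ - _).
  by apply: eq_bigr => P _; rewrite big_distrr.
rewrite (exchange_big_dep xpredT) //=; apply: eq_bigr => P _.
by rewrite big_distrr; apply: eq_bigl => Q; rewrite bipartition_sym.
Qed.

Lemma near_balanced_sum_ge0 (R : numDomainType) S (z : R) :
  0 <= z -> 0 <= near_balanced_sum S z.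
Proof.
move=> z0; apply: sumr_ge0 => P _; apply: sumr_ge0 => Q _.
by case: ifP => // _; apply: exprn_ge0.
Qed.

Lemma independent0 : independent (set0 : {set V}).
Proof. by apply/independentP => u w; rewrite inE. Qed.

Lemma independent1 (u : V) : independent [set u].
Proof. by apply/independentP => a b /set1P-> /set1P->; rewrite adj_irr. Qed.

Lemma near_balanced_sum1 (R : numDomainType) (u : V) (z : R) :
  0 <= z -> 0 < near_balanced_sum [set u] z.
Proof.
(* The pair [P = set0], [Q = [set u]] contributes [z ^+ 0 = 1], whence strict positivity even at
   [z = 0]. *)
move=> z0; rewrite /near_balanced_sum (bigD1 set0) //= (bigD1 [set u]) /=; last first.
  by rewrite /bipartition independent0 independent1 set0I set0U !eqxx.
rewrite cards0 cards1 eqxx expr0 -addrA ltr_wpDr ?ltr01 //.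
have t0 (P Q : {set V}) : 0 <= (if #|Q| == #|P|.+1 then z ^+ #|P| else 0).
  by case: ifP => // _; apply: exprn_ge0.
apply: addr_ge0; apply: sumr_ge0 => P _; last exact: sumr_ge0.
by case: ifP => _; rewrite ?ler01 ?exprn_ge0.
Qed.

Lemma indep_sum0 (R : pzSemiRingType) (x : R) : indep_sum set0 x = 1.
Proof.
rewrite /indep_sum (big_pred1 set0) ?cards0 ?expr0 // => A /=.
by rewrite subset0; case: eqP => // ->; rewrite independent0.
Qed.

Lemma rmorph_indep_sum (R R' : pzSemiRingType) (f : {rmorphism R -> R'}) U (x : R) :
  f (indep_sum U x) = indep_sum U (f x).
Proof. by rewrite rmorph_sum; apply: eq_bigr => A _; rewrite rmorphXn. Qed.

Theorem indep_sum_neq0 (C : numClosedFieldType) U (x : C) :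
  claw_free G -> x \isn't Num.real -> indep_sum U x != 0.
Proof.
move=> cf xNr; have [n] := ubnP #|U|; elim: n U => // n IH U.
have [->|[u uU]] := set_0Vmem U; first by rewrite indep_sum0 oner_neq0.
rewrite ltnS => leU; apply/eqP => I0.
(* The coefficients are integers, so the conjugate of [x] is a zero too and the right-hand side
   vanishes. *)
have := indep_sum_deriv U x x^*; rewrite christoffel_darboux.
rewrite -rmorph_indep_sum /= I0 rmorph0 mul0r mulr0 subrr.
under eq_bigr => S /andP[cS _] do
  rewrite bipart_weightE // -rmorph_indep_sum -!normCK -mulrA.
rewrite -big_distrr /= => /eqP; rewrite mulf_eq0 subr_eq0.
have zz0 : 0 <= `|x| ^+ 2 by rewrite exprn_ge0.
(* In the remaining sum of nonnegative terms, the one for [[set u]] is positive: removing the closed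
   neighbourhood of [u] leaves a smaller set, to which the induction hypothesis applies. *)
rewrite -CrealE (negbTE xNr) /= (bigD1 [set u]) /=; last first.
  by rewrite connected1 sub1set.
rewrite gt_eqF //; apply: ltr_wpDr.
  by apply: sumr_ge0 => S _; apply: mulr_ge0; [exact: near_balanced_sum_ge0 | exact: exprn_ge0].
rewrite mulr_gt0 ?near_balanced_sum1 ?exprn_gt0 // normr_gt0; apply: IH.
apply: leq_trans leU; apply: proper_card; apply/properP; split; first exact: subsetDl.
by exists u; rewrite // !inE eqxx.
Qed.
End IndepSum.

(** * Factorisation of the independence polynomial *)

Section Positivity.
Variable G : sgraph.
Local Notation V := (vertex G).
Implicit Types (A B P Q S T U W : {set V}).

Lemma indep_sum_rec (R : comPzSemiRingType) U (u : V) (x : R) : u \in U ->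
  indep_sum U x =
  indep_sum (U :\ u) x + x * indep_sum ((U :\ u) :\: [set w | adj u w]) x.
Proof.
move=> uU; rewrite {1}/indep_sum (big_set_split [set u]).
rewrite (bigD1 set0) /= ?sub0set //; congr (_ + _).
  apply: eq_big => [A|A _]; rewrite set0U // subsetD1 -andbA andbC -andbA.
  by rewrite subsetC sub1set inE; do !bool_congr.
rewrite (big_pred1 [set u]); last first.
  move=> P /=; rewrite subset1; case: (P =P [set u]) => [->|_] /=.
    by rewrite -card_gt0 cards1.
  by case: eqP.
rewrite big_distrr /=; apply: eq_big => [A|A /andP[sA _]]; last first.
  rewrite subsetC sub1set inE in sA.
  by rewrite cardsU1 sA exprS.
rewrite subUset sub1set uU /= independentU independent1 /=.
have -> : (A \subset ~: [set u]) = (u \notin A).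
  by rewrite subsetC sub1set inE.
have -> : (A \subset U :\ u :\: [set w | adj u w]) =
    [&& A \subset U, u \notin A & separated [set u] A].
  rewrite subsetD subsetD1 -andbA; congr [&& _, _ & _].
  rewrite disjoints_subset; apply/subsetP/separatedP => [h a w /set1P-> wA|h w wA].
    by have := h w wA; rewrite !inE.
  by rewrite !inE h ?set11.
by do !bool_congr.
Qed.

Section RealField.
Variable (R : realFieldType) (a t : R) (d : nat).
Hypothesis deg_le : forall u : V, (degree u <= d)%N.
Hypotheses (a_ge0 : 0 <= a) (a_lt1 : a < 1).
Hypothesis t_le : t <= a * (1 - a) ^+ d.
Local Notation I U := (indep_sum U (- t)).

(** The vertices of [U :\: W] are removed one by one, each costing a factor [1 - a]. The ratio bound
    is a hypothesis because this is invoked inside the induction that proves it. *)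
Lemma indep_sum_subset_le U W :
  (forall T, T \subset U -> forall u, u \in T -> (1 - a) * I (T :\ u) <= I T) ->
  W \subset U -> (1 - a) ^+ #|U :\: W| * I W <= I U.
Proof.
have [n] := ubnP #|U :\: W|; elim: n U => // n IH U ltn h sWU.
have [/eqP|[u uUW]] := set_0Vmem (U :\: W).
  rewrite setD_eq0 => sUW; have -> : U = W by apply/eqP; rewrite eqEsubset sUW.
  by rewrite setDv cards0 expr0 mul1r.
have E : (U :\ u) :\: W = (U :\: W) :\ u by rewrite !setDDl setUC.
have c : #|U :\: W| = #|(U :\ u) :\: W|.+1 by rewrite E (cardsD1 u (U :\: W)) uUW.
have /setDP[uU uW] := uUW.
apply: le_trans (h U (subxx _) u uU).
rewrite c exprS -mulrA ler_pM2l ?subr_gt0 //; apply: IH.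
- by rewrite c in ltn.
- by move=> T sT; apply: h; apply: subset_trans sT (subsetDl _ _).
- by rewrite subsetD1 sWU.
Qed.

(** The induction of the Lovász local lemma, whose condition is [t_le]. In [I(U) = I(U - u) - t I(U
    - N[u])], at most [d] further vertices separate the last set from [U - u], so the subtracted
    term is at most [a I(U - u)]. *)
Lemma indep_sum_neg_bound U : 0 < I U /\
  forall u, u \in U -> (1 - a) * I (U :\ u) <= I U.
Proof.
have [n] := ubnP #|U|; elim: n U => // n IH U; rewrite ltnS => leU.
suff step u : u \in U -> 0 < I (U :\ u) /\ (1 - a) * I (U :\ u) <= I U.
  split; last by move=> u /step[].
  have [->|[u /step[I0]]] := set_0Vmem U; first by rewrite indep_sum0 ltr01.
  by apply: lt_le_trans; rewrite mulr_gt0 ?subr_gt0.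
move=> uU.
have small T : T \subset U :\ u -> (#|T| < n)%N.
  move=> sT; apply: leq_trans leU; rewrite (cardsD1 u U) uU ltnS.
  exact: subset_leq_card.
have [I0 _] := IH _ (small _ (subxx _)); split=> //.
rewrite (indep_sum_rec _ uU) mulNr.
set W := _ :\: [set _ | _].
have sW : W \subset U :\ u by apply: subsetDl.
have [W0 _] := IH _ (small _ sW).
have := @indep_sum_subset_le (U :\ u) W (fun T sT => (IH T (small T sT)).2) sW.
set m := #|_| => le1.
have lem : (m <= d)%N.
  apply: leq_trans (deg_le u); apply: subset_leq_card; rewrite /W setDDr setDv set0U.
  exact: subsetIr.
have a1 : 0 <= 1 - a by rewrite subr_ge0 ltW.
have le2 : (1 - a) ^+ d * I W <= I (U :\ u).
  apply: le_trans le1; apply: ler_wpM2r; first exact: ltW.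
  by apply: ler_wiXn2l => //; rewrite gerBl.
rewrite mulrBl mul1r lerD2l lerN2.
apply: le_trans (ler_wpM2r (ltW W0) t_le) _.
by rewrite -mulrA; apply: ler_wpM2l.
Qed.

End RealField.

Lemma bernoulli_le (R : realFieldType) (a : R) n : 0 <= a <= 1 ->
  1 - n%:R * a <= (1 - a) ^+ n.
Proof.
case/andP=> a0 a1; elim: n => [|n IH]; first by rewrite mul0r subr0 expr0.
rewrite exprS; apply: le_trans (ler_wpM2l _ IH); last by rewrite subr_ge0.
have -> : 1 - n.+1%:R * a = (1 - a) * (1 - n%:R * a) - n%:R * (a * a).
  by rewrite -natr1; ring.
by rewrite gerBl !mulr_ge0.
Qed.

Lemma indep_sum_neg_gt0 (R : realFieldType) (t : R) (d : nat) U :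
  (forall u : V, (degree u <= d)%N) -> (0 < d)%N ->
  t <= (4 * d%:R)^-1 -> 0 < indep_sum U (- t).
Proof.
move=> deg d0 t1.
have D0 : 0 < d%:R :> R by rewrite ltr0n.
(* With [d a = 1/2], Bernoulli gives [(1 - a) ^ d >= 1/2], hence [a (1 - a) ^ d >= 1 / (4 d)]. *)
pose a : R := (2 * d%:R)^-1.
have a0 : 0 <= a by rewrite invr_ge0 mulr_ge0.
have a1 : a < 1.
  by rewrite invf_lt1 ?mulr_gt0 // -natrM ltr1n; case: (d) d0 => // d' _; rewrite mulnS.
have da : d%:R * a = 2^-1 by rewrite /a invfM mulrCA mulfV ?mulr1 // gt_eqF.
have ta : t <= a * (1 - a) ^+ d.
  have := @bernoulli_le _ a d; rewrite a0 ltW // => /(_ isT); rewrite da => h.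
  apply: le_trans t1 _; apply: le_trans (ler_wpM2l a0 h).
  by rewrite /a !invfM; lra.
by have [] := indep_sum_neg_bound deg a0 a1 ta U.
Qed.

End Positivity.

Section Factor.
Variable G : sgraph.
Local Notation V := (vertex G).

Definition indep_poly (R : nzSemiRingType) : {poly R} := indep_sum [set: V] 'X.

Lemma coef_indep_poly (R : nzSemiRingType) k :
  (indep_poly R)`_k = (num_indep_k G k)%:R.
Proof.
rewrite coef_sum /num_indep_k -sum1_card natr_sum [RHS]big_mkcond [LHS]big_mkcond /=.
apply: eq_bigr => A _; rewrite inE subsetT coefXn eq_sym /=.
by case: (independent A) => //=; case: eqP.
Qed.

Lemma horner_indep_poly (R : comNzRingType) (x : R) :
  (indep_poly R).[x] = indep_sum [set: V] x.
Proof.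
by rewrite -horner_evalE rmorph_indep_sum /= horner_evalE hornerX.
Qed.

Lemma indep_poly1 (R : comNzRingType) : (indep_poly R).[1] = (num_indep G)%:R.
Proof.
rewrite horner_indep_poly /num_indep -sum1_card natr_sum.
by apply: eq_big => [A|A _]; rewrite ?inE ?subsetT // expr1n.
Qed.

Lemma size_indep_poly (R : nzSemiRingType) : (size (indep_poly R) <= (num_vertices G).+1)%N.
Proof.
apply: leq_trans (size_sum _ _ _) _; apply/bigmax_leqP => A _.
by rewrite size_polyXn ltnS max_card.
Qed.

(** The complex roots are real and lie below [- 1 / (4 d)]; the numbers [a] are their negated
    reciprocals. *)
Lemma indep_poly_factor (R : rcfType) (d : nat) : claw_free G ->
  (forall u : V, (degree u <= d)%N) -> (0 < d)%N ->
  exists s : seq R, [/\ size s = num_vertices G,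
    {in s, forall a, 0 <= a <= 4 * d%:R} &
    indep_poly R = \prod_(a <- s) (1 + a *: 'X)].
Proof.
move=> cf deg d0; set p := indep_poly R.
have [r rE] := closed_field_poly_normal (map_poly (real_complex R) p).
have pcE (z : R[i]) : (map_poly (real_complex R) p).[z] = indep_sum [set: V] z.
  rewrite -horner_indep_poly /p /indep_poly; congr (_.[z]).
  by rewrite rmorph_indep_sum /= map_polyX.
have rreal z : z \in r -> z = (complex.Re z)%:C%C.
  move=> zr; apply/esym/RRe_real; apply: contraT => /(indep_sum_neq0 setT cf)/eqP[].
  rewrite -pcE rE hornerZ; apply/eqP; rewrite mulf_eq0; apply/orP; right.
  by rewrite -rootE root_prod_XsubC.
pose x := map (@complex.Re R) r.
have pE : p = lead_coef p *: \prod_(z <- x) ('X - z%:P).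
  apply: (@map_poly_inj _ _ (real_complex R)); rewrite rE lead_coef_map.
  rewrite map_polyZ rmorph_prod big_map /=; congr (_ *: _).
  apply: eq_big_seq => z zr /=.
  by rewrite rmorphB /= map_polyX map_polyC /= -rreal.
have p0 : p.[0] = 1.
  rewrite horner_indep_poly /indep_sum (bigD1 set0) ?subsetT ?independent0 //=.
  rewrite cards0 expr0 big1 ?addr0 // => A /andP[_ A0].
  by rewrite expr0n cards_eq0 (negbTE A0).
have lc0 : lead_coef p != 0.
  rewrite lead_coef_eq0; apply/eqP => p00.
  by move/eqP: p0; rewrite p00 horner0 eq_sym oner_eq0.
have xroot z : z \in x -> p.[z] = 0.
  by move=> zx; rewrite pE hornerZ (rootP _) ?mulr0 // root_prod_XsubC.
have xneg z : z \in x -> z < - (4 * d%:R)^-1.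
  move=> zx; rewrite ltNge; apply/negP => zge.
  have := xroot z zx; have [z0|z0] := lerP 0 z; rewrite horner_indep_poly => /eqP.
    rewrite gt_eqF // /indep_sum (bigD1 set0) ?subsetT ?independent0 //=.
    rewrite cards0 expr0 ltr_wpDr ?ltr01 // sumr_ge0 // => A _.
    exact: exprn_ge0.
  rewrite -[z]opprK gt_eqF // (indep_sum_neg_gt0 _ deg) //.
  by rewrite lerNl.
have d4 : 0 < 4 * d%:R :> R by rewrite mulr_gt0 ?ltr0n.
have xneg0 z : z \in x -> z < 0.
  by move=> /xneg /lt_trans; apply; rewrite oppr_lt0 invr_gt0.
have sx : (size x <= num_vertices G)%N.
  rewrite -ltnS; apply: leq_trans (size_indep_poly R).
  by rewrite -/p pE size_scale // size_prod_XsubC.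
have {}pE : p = \prod_(z <- x) (1 + (- z^-1) *: 'X).
  have E : \prod_(z <- x) ('X - z%:P) =
    (\prod_(z <- x) (- z)) *: \prod_(z <- x) (1 + (- z^-1) *: 'X).
    rewrite -mul_polyC rmorph_prod -big_split /=; apply: eq_big_seq => z /xneg0 z0.
    by rewrite mul_polyC scalerDr scalerA mulrNN mulfV ?lt_eqF // scale1r alg_polyC polyCN addrC.
  (* The scalar is the value at [0], where every factor [1 + a X] equals 1. *)
  rewrite pE E scalerA -[RHS]scale1r; congr (_ *: _).
  move: p0; rewrite {1}pE E scalerA hornerZ horner_prod [X in _ * X]big1 ?mulr1 // => z _.
  by rewrite !hornerE ?mulr0 ?addr0.
(* The degree may be less than the number of vertices. Padding with zeros makes lists of different
   graphs equally long. *)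
exists (map (fun z => - z^-1) x ++ nseq (num_vertices G - size x) 0); split.
- by rewrite size_cat size_map size_nseq subnKC.
- move=> a; rewrite mem_cat => /orP[/mapP[z zx ->]|/nseqP[-> _]]; last first.
    by rewrite lexx ltW.
  rewrite oppr_ge0 invr_le0 ltW ?xneg0 //= -invrN -[leRHS]invrK.
  by rewrite lef_pV2 ?posrE ?invr_gt0 ?oppr_gt0 ?xneg0 // lerNr ltW ?xneg.
- rewrite pE big_cat [in RHS]big_map /= [X in _ = _ * X]big1_seq ?mulr1 //.
  by move=> i /= /nseqP[-> _]; rewrite scale0r addr0.
Qed.
End Factor.

(** * Newton's identities *)

Section PowerSums.
Variable F : fieldType.
Implicit Types (s t : seq F) (p q : {poly F}).

Definition root_product s : {poly F} := \prod_(a <- s) (1 + a *: 'X).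

(** The power series of [a / (1 + a X)], the logarithmic derivative of [1 + a X], cut off at
    [X ^ K]. *)
Definition log_deriv_trunc K (a : F) : {poly F} :=
  \sum_(j < K) ((-1) ^+ j * a ^+ j.+1) *: 'X^j.

Lemma log_deriv_truncE K a :
  (1 + a *: 'X) * log_deriv_trunc K a = a%:P - ((-1) ^+ K * a ^+ K.+1) *: 'X^K.
Proof.
elim: K => [|K IH].
  by rewrite /log_deriv_trunc big_ord0 mulr0 expr0 expr1 mul1r alg_polyC subrr.
rewrite /log_deriv_trunc big_ord_recr /= mulrDr IH !exprS -!mul_polyC !polyCM !polyCN.
by ring.
Qed.

Lemma dvdpXnP K p :
  reflect (forall j, (j < K)%N -> p`_j = 0) ('X^K %| p).
Proof.
apply: (iffP idP) => [/dvdpP[q ->] j lt|h]; first by rewrite coefMXn lt.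
apply/dvdpP; exists (drop_poly K p); rewrite -[LHS](poly_take_drop K).
rewrite [X in X + _](_ : _ = 0) ?add0r //; apply/polyP => j.
by rewrite coef_take_poly coef0; case: ifP => // /h.
Qed.

(** Newton's identities in generating form: modulo [X ^ K], the logarithmic derivative of a product
    is the sum of those of its factors. *)
Lemma dvdp_root_product_deriv K s :
  'X^K %| (root_product s)^`() - root_product s * \sum_(a <- s) log_deriv_trunc K a.
Proof.
elim: s => [|a s IH].
  by rewrite /root_product !big_nil derivC mulr0 subrr dvdp0.
rewrite /root_product !big_cons -!/(root_product s).
set E := root_product s; set H := \sum_(_ <- _) _.
have -> : ((1 + a *: 'X) * E)^`() - (1 + a *: 'X) * E * (log_deriv_trunc K a + H) =
   (1 + a *: 'X) * (E^`() - E * H) + a%:P * E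
   - E * ((1 + a *: 'X) * log_deriv_trunc K a).
  rewrite derivM derivD derivC add0r derivZ derivX alg_polyC.
  by ring.
rewrite log_deriv_truncE -!mul_polyC.
set c := (_ * _)%:P.
have -> : (1 + a%:P * 'X) * (E^`() - E * H) + a%:P * E - E * (a%:P - c * 'X^K)
  = (1 + a%:P * 'X) * (E^`() - E * H) + (E * c) * 'X^K by ring.
by rewrite dvdp_add ?dvdp_mulIr // dvdp_mull.
Qed.

Lemma power_sum_eq K s t :
  (forall k, (k <= K)%N -> (root_product s)`_k = (root_product t)`_k) ->
  forall j, (0 < j <= K)%N -> \sum_(a <- s) a ^+ j = \sum_(a <- t) a ^+ j.
Proof.
move=> h [//|j] /= ltj.
pose H s := \sum_(a <- s) log_deriv_trunc K a.
have coefH u : (H u)`_j = (-1) ^+ j * \sum_(a <- u) a ^+ j.+1.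
  rewrite coef_sum big_distrr /=; apply: eq_bigr => a _.
  rewrite coef_sum (bigD1 (Ordinal ltj)) //= coefZ coefXn eqxx mulr1.
  rewrite big1 ?addr0 // => i ne; rewrite coefZ coefXn.
  by case: eqP => [e|_]; rewrite ?mulr0 //; case/eqP: ne; apply/val_inj.
(* Coefficient [i < K] of a derivative involves coefficient [i + 1 <= K] of the polynomial. *)
have dE : 'X^K %| (root_product s)^`() - (root_product t)^`().
  by apply/dvdpXnP => i lti; rewrite coefB !coef_deriv h // subrr.
have dE2 : 'X^K %| root_product s - root_product t.
  by apply/dvdpXnP => i lti; rewrite coefB h ?subrr // ltnW.
have : 'X^K %| root_product s * (H s - H t).
  have -> : root_product s * (H s - H t) =
    ((root_product s)^`() - (root_product t)^`())
    - ((root_product s)^`() - root_product s * H s)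
    + ((root_product t)^`() - root_product t * H t)
    - (root_product s - root_product t) * H t by ring.
  by rewrite dvdp_sub ?dvdp_mulr // dvdp_add ?dvdp_root_product_deriv //
     dvdp_sub ?dvdp_root_product_deriv.
(* The constant term is 1, so the product is coprime to [X ^ K] and can be cancelled. *)
rewrite Gauss_dvdpr; last first.
  rewrite coprimep_expl // coprimep_sym coprimepX -[0]/(0%R) /root horner_prod big1 ?oner_eq0 //.
  by move=> a _; rewrite !hornerE ?mulr0 ?addr0.
move=> /dvdpXnP /(_ j ltj) /eqP; rewrite coefB subr_eq0 !coefH => /eqP.
by apply: mulfI; rewrite signr_eq0.
Qed.

(** Equality of sizes supplies the power sum of order 0. *)
Lemma horner_sum_eq K s t p : size s = size t ->
  (forall k, (k <= K)%N -> (root_product s)`_k = (root_product t)`_k) ->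
  (size p <= K.+1)%N ->
  \sum_(a <- s) p.[a] = \sum_(a <- t) p.[a].
Proof.
move=> est h sp.
have E u : \sum_(a <- u) p.[a] = \sum_(i < K.+1) p`_i * \sum_(a <- u) a ^+ i.
  under eq_bigr do rewrite (horner_coef_wide _ sp).
  by rewrite exchange_big; apply: eq_bigr => i _; rewrite big_distrr.
rewrite !E; apply: eq_bigr => -[[|i] lti] _ /=; congr (_ * _).
  by under eq_bigr do rewrite expr0; under [RHS]eq_bigr do rewrite expr0;
    rewrite !big_const_seq !count_predT est.
by apply: (power_sum_eq h).
Qed.

End PowerSums.

(** * Chebyshev expansion of the logarithm *)

Section Chebyshev.
Variable R : comPzRingType.

(* [chebyshev n] evaluates at [cos u] to [(cos (n u), sin (n u) / sin u)]. *)
Fixpoint chebyshev (n : nat) (c : R) : R * R :=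
  if n is m.+1 then
    let: (t, u) := chebyshev m c in (c * t - (1 - c ^+ 2) * u, c * u + t)
  else (1, 0).

(** The Pythagorean identity for [n u] at [c = cos u]; it bounds the first component on [[-1, 1]]
    without trigonometry. *)
Lemma chebyshev_pell n c :
  (chebyshev n c).1 ^+ 2 + (1 - c ^+ 2) * (chebyshev n c).2 ^+ 2 = 1.
Proof.
elim: n => [|n] /=; first by rewrite expr1n expr0n mulr0 addr0.
by case: (chebyshev n c) => t u /= h; rewrite -[RHS]h; ring.
Qed.

Lemma chebyshev_rec n c :
  (chebyshev n.+2 c).1 = 2 * c * (chebyshev n.+1 c).1 - (chebyshev n c).1.
Proof. by rewrite /=; case: (chebyshev n c) => t u /=; ring. Qed.

End Chebyshev.

Lemma rmorph_chebyshev (R R' : comPzRingType) (f : {rmorphism R -> R'}) n c :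
  chebyshev n (f c) = (f (chebyshev n c).1, f (chebyshev n c).2).
Proof.
elim: n => [|n IH] /=; first by rewrite rmorph1 rmorph0.
rewrite IH; case: (chebyshev n c) => t u /=.
by rewrite !(rmorphB, rmorphD, rmorphM, rmorph1, rmorphXn).
Qed.

Lemma size_chebyshev (R : comNzRingType) n :
  (size (chebyshev n ('X : {poly R})).1 <= n.+1)%N /\
  (size (chebyshev n ('X : {poly R})).2 <= n)%N.
Proof.
elim: n => [|n] /=; first by rewrite size_poly1 size_poly0.
have szM (p q : {poly R}) a b :
    (size p <= a.+1)%N -> (size q <= b)%N -> (size (p * q)%R <= a + b)%N.
  move=> sp sq; apply: leq_trans (size_polyMleq _ _) _.
  by rewrite -subn1 leq_subLR; apply: leq_trans (leq_add sp sq) _.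
case: (chebyshev n _) => t u /= [st su].
have szX : (size ('X : {poly R}) <= 2)%N by rewrite size_polyX.
split; apply: leq_trans (size_polyD _ _) _; rewrite geq_max.
  have s2 : (size (1 - 'X^2 : {poly R})%R <= 3)%N.
    by apply: leq_trans (size_polyD _ _) _; rewrite size_polyN size_polyXn size_poly1.
  by rewrite size_polyN (szM _ _ 1%N n.+1) // (szM _ _ 2%N n).
by rewrite st (szM _ _ 1%N n).
Qed.

Lemma chebyshev_norm_le1 (R : realDomainType) n (c : R) :
  -1 <= c <= 1 -> `|(chebyshev n c).1| <= 1.
Proof.
move=> /andP[c0 c1]; have := chebyshev_pell n c.
case: (chebyshev n c) => t u /= h; have : 0 <= (1 - c ^+ 2) * u ^+ 2.
  by apply: mulr_ge0; [nra|rewrite exprn_even_ge0].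
by move=> h'; rewrite ler_norml; apply/andP; split; nra.
Qed.

(** The full series would be [(2 c + 2 t) / (1 + 2 c t + t ^ 2)], the derivative in [t] of
    [ln (1 + 2 c t + t ^ 2)]; the last term is the exact remainder. *)
Lemma chebyshev_geometric_sum (R : comPzRingType) (c t : R) K :
  (1 + 2 * c * t + t ^+ 2) *
    \sum_(k < K) 2 * (-1) ^+ k * (chebyshev k.+1 c).1 * t ^+ k =
  2 * c + 2 * t - 2 * (-1) ^+ K *
    ((chebyshev K.+1 c).1 * t ^+ K + (chebyshev K c).1 * t ^+ K.+1).
Proof.
elim: K => [|K IH]; first by rewrite big_ord0 /= !expr0; ring.
rewrite big_ord_recr mulrDr IH chebyshev_rec !exprS.
by move: (chebyshev K.+1 c).1 (chebyshev K c).1 => a b /=; ring.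
Qed.

Section LogApproximation.
Variable R : realType.
Implicit Types (c r t : R) (K : nat).

(** The Taylor polynomial of [ln (1 + 2 c t + t ^ 2)] in [t], of order [K]. *)
Definition log_series c K : {poly R} :=
  \sum_(k < K) (2 * (-1) ^+ k * (chebyshev k.+1 c).1 / k.+1%:R) *: 'X^(k.+1).

Lemma deriv_log_series c K t :
  (log_series c K)^`().[t] =
  \sum_(k < K) 2 * (-1) ^+ k * (chebyshev k.+1 c).1 * t ^+ k.
Proof.
rewrite raddf_sum horner_sum; apply: eq_bigr => k _.
rewrite /= derivZ derivXn hornerZ hornerMn hornerXn -[t ^+ _ *+ _]mulr_natr /=.
by rewrite [t ^+ k * _]mulrC mulrA divfK // pnatr_eq0.
Qed.

(** The mean value theorem on [[0, r]]: the difference vanishes at [0], and its derivative is the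
    remainder of the geometric sum divided by [1 + 2 c t + t ^ 2]. *)
Lemma log_series_approx c r K : -1 <= c <= 1 -> 0 <= r < 1 ->
  `|ln (1 + 2 * c * r + r ^+ 2) - (log_series c K).[r]| <= 4 * r ^+ K.+1 / (1 - r) ^+ 2.
Proof.
move=> c1 /andP[r0 r1].
pose q : {poly R} := 1 + (2 * c) *: 'X + 'X^2.
have qE t : q.[t] = 1 + 2 * c * t + t ^+ 2 by rewrite !hornerE.
(* As [c >= -1], the value is at least [(1 - t) ^ 2]. *)
have q_ge t : 0 <= t -> t <= r -> (1 - r) ^+ 2 <= q.[t].
  move=> t0 tr; rewrite qE; case/andP: c1 => c1 c2; nra.
have r2 : 0 < (1 - r) ^+ 2 by rewrite exprn_gt0 // subr_gt0.
pose f t := ln q.[t] - (log_series c K).[t].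
pose df t := q.[t]^-1 * q^`().[t] - (log_series c K)^`().[t].
have fD t : 0 <= t -> t <= r -> is_derive t 1 f (df t).
  move=> t0 tr; have qt : 0 < q.[t] := lt_le_trans r2 (q_ge t t0 tr).
  apply: is_deriveB.
  apply: (@is_derive1_comp _ (@ln R) (horner q)); exact: is_derive1_ln.
have fC : {within `[0, r], continuous f}%classic.
  apply: derivable_within_continuous => t; rewrite in_itv /= => /andP[t0 tr].
  exact: (@ex_derive _ _ _ _ _ _ _ (fD t t0 tr)).
have [|t] := @MVT_segment _ f df 0 r r0 _ fC.
  move=> t; rewrite in_itv /= => /andP[t0 tr]; exact: fD (ltW t0) (ltW tr).
rewrite in_itv /= => /andP[t0 tr].
have -> : f 0 = 0.
  rewrite /f qE mulr0 addr0 expr0n addr0 ln1 sub0r /log_series horner_sum big1 ?oppr0 // => k _.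
  by rewrite hornerZ hornerXn expr0n mulr0.
rewrite !subr0 /f qE => ->.
have qt : 0 < q.[t] := lt_le_trans r2 (q_ge t t0 tr).
have dfE : df t = q.[t]^-1 * (2 * (-1) ^+ K *
    ((chebyshev K.+1 c).1 * t ^+ K + (chebyshev K c).1 * t ^+ K.+1)).
  rewrite /df; apply: (mulfI (lt0r_neq0 qt)); rewrite mulrBr !mulVKf ?lt0r_neq0 //.
  rewrite deriv_log_series qE chebyshev_geometric_sum.
  have -> : q^`().[t] = 2 * c + 2 * t.
    by rewrite /q !(derivD, derivC, derivZ, derivX, derivXn) !(hornerE, hornerMn) /=; ring.
  by ring.
rewrite dfE normrM normrM [`|q.[t]^-1|]gtr0_norm ?invr_gt0 // (ger0_norm r0).
have b : `|2 * (-1) ^+ K *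
    ((chebyshev K.+1 c).1 * t ^+ K + (chebyshev K c).1 * t ^+ K.+1)| <= 4 * r ^+ K.
  rewrite normrM normrM normr_sign mulr1 ger0_norm //.
  suff : `|(chebyshev K.+1 c).1 * t ^+ K + (chebyshev K c).1 * t ^+ K.+1| <= r ^+ K + r ^+ K by lra.
  apply: le_trans (ler_normD _ _) _; apply: lerD;
    rewrite normrM -[leRHS]mul1r ler_pM ?normr_ge0 ?chebyshev_norm_le1 //.
    by rewrite ger0_norm ?exprn_ge0 // lerXn2r ?nnegrE.
  rewrite ger0_norm ?exprn_ge0 // exprS -[leRHS]mul1r ler_pM ?exprn_ge0 //.
    by rewrite (le_trans tr) // ltW.
  by rewrite lerXn2r ?nnegrE.
have -> : 4 * r ^+ K.+1 / (1 - r) ^+ 2 = ((1 - r) ^+ 2)^-1 * (4 * r ^+ K) * r.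
  by rewrite exprSr; ring.
apply: ler_wpM2r => //; apply: ler_pM => //; first by rewrite invr_ge0 ltW.
by rewrite lef_pV2 ?posrE // q_ge.
Qed.

(** For [M > 0], the solution in [(0, 1)] of [(r + 1 / r) / 2 = 1 + 2 / M]. The affine map from
    [[0, M]] onto [[-1, 1]] sends the singularity [a = -1] of [ln (1 + a)] to [- (1 + 2 / M)]. *)
Definition joukowski_radius (M : R) : R := (Num.sqrt (1 + M) - 1) / (Num.sqrt (1 + M) + 1).

(* For [s := sqrt (1 + M)], [r := (s - 1) / (s + 1)] and [c := 2 a / M - 1], one has
   [1 + a = (s + 1) ^ 2 / 4 * (1 + 2 c r + r ^ 2)]. *)
Lemma ln_poly_approx (M : R) K : 0 < M ->
  exists2 p : {poly R}, (size p <= K.+1)%N &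
    forall a, 0 <= a <= M -> `|ln (1 + a) - p.[a]| <=
      4 * joukowski_radius M ^+ K.+1 / (1 - joukowski_radius M) ^+ 2.
Proof.
move=> M0; rewrite /joukowski_radius; set s := Num.sqrt _; set r := (s - 1) / (s + 1).
have s2 : s ^+ 2 = 1 + M by rewrite sqr_sqrtr // addr_ge0 // ltW.
have s0 : 0 <= s by apply: sqrtr_ge0.
have s1 : 1 < s by rewrite -(ltr_pXn2r (ltn0Sn 1)) ?nnegrE // expr1n s2 ltrDl.
have sp : 0 < s + 1 by lra.
have r01 : 0 <= r < 1.
  by rewrite /r ltr_pdivrMr // divr_ge0 ?(ltW sp) ?subr_ge0 ?(ltW s1) //=; lra.
pose C := (s + 1) ^+ 2 / 4.
have C0 : 0 < C by rewrite divr_gt0 // exprn_gt0.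
(* The expansion of [log_series] with the roles exchanged: [r] is fixed and [c] is the variable, so
   the degree is at most [K]. *)
pose p := (\sum_(k < K) (2 * (-1) ^+ k / k.+1%:R * r ^+ k.+1) *: (chebyshev k.+1 'X).1) : {poly R}.
exists ((ln C)%:P + (p \Po ((2 / M) *: 'X - 1))).
  apply: leq_trans (size_polyD _ _) _; rewrite geq_max; apply/andP; split.
    by rewrite size_polyC; case: eqP.
  apply: leq_trans (size_comp_poly_leq _ _) _; rewrite ltnS.
  have sz1 : (size ((2 / M) *: 'X - 1 : {poly R})%R <= 2)%N.
    apply: leq_trans (size_polyD _ _) _; rewrite geq_max size_polyN size_poly1 andbT.
    by apply: leq_trans (size_scale_leq _ _) _; rewrite size_polyX.
  have szp : (size p <= K.+1)%N.
    apply: leq_trans (size_sum _ _ _) _; apply/bigmax_leqP => k _.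
    apply: leq_trans (size_scale_leq _ _) _.
    by apply: leq_trans (size_chebyshev _ _).1 _; rewrite ltnS.
  apply: leq_trans (leq_mul (_ : _ <= K) (_ : _ <= 1))%N _; last by rewrite muln1.
    by rewrite -subn1 leq_subLR add1n.
  by rewrite -subn1 leq_subLR addn1.
move=> a /andP[a0 aM]; set c := 2 / M * a - 1.
have c1 : -1 <= c <= 1.
  have h0 : 0 <= 2 / M * a by rewrite mulr_ge0 ?divr_ge0 // ltW.
  have h1 : 2 / M * a <= 2 by rewrite mulrAC ler_pdivrMr // ler_pM2l.
  by apply/andP; split; rewrite /c; lra.
have pE : (p \Po ((2 / M) *: 'X - 1)).[a] = (log_series c K).[r].
  rewrite horner_comp.
  have -> : ((2 / M) *: 'X - 1).[a] = c by rewrite !hornerE.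
  rewrite /p /log_series !horner_sum; apply: eq_bigr => k _.
  rewrite !hornerZ hornerXn.
  have -> n : (chebyshev n 'X).1.[c] = (chebyshev n c).1.
    have /= := rmorph_chebyshev (horner_eval c) n 'X.
    by rewrite !horner_evalE hornerX => ->.
  by ring.
have aE : 1 + a = C * (1 + 2 * c * r + r ^+ 2).
  have Ms : M = (s - 1) * (s + 1) by rewrite -[M](addKr 1) -s2; ring.
  have sm : s - 1 != 0 by rewrite subr_eq0 gt_eqF.
  rewrite /c /C /r Ms; field.
  by rewrite sm gt_eqF.
have q0 : 0 < 1 + 2 * c * r + r ^+ 2.
  by rewrite -(pmulr_rgt0 _ C0) -aE ltr_pwDl.
rewrite aE lnM ?posrE // hornerD hornerC pE opprD addrACA subrr add0r.
exact: log_series_approx.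
Qed.

End LogApproximation.

(** * Error estimate *)

Section Truncation.
Variable R : realType.

Lemma ln_root_product1 (s : seq R) : {in s, forall a, 0 <= a} ->
  0 < (root_product s).[1] /\ ln (root_product s).[1] = \sum_(a <- s) ln (1 + a).
Proof.
rewrite /root_product; elim: s => [|a s IH] h.
  by rewrite !big_nil hornerC ln1 ltr01.
have [|p e] := IH; first by move=> b bs; apply: h; rewrite inE bs orbT.
have a0 : 0 < 1 + a by rewrite ltr_pwDl // h // mem_head.
have E : (1 + a *: 'X).[1] = 1 + a by rewrite !hornerE.
rewrite !big_cons hornerM E; split; first exact: mulr_gt0.
by rewrite lnM ?posrE // e.
Qed.

(** The approximating polynomial has equal sums over [s] and [t], so only the two approximation
    errors remain, whence [8 = 2 * 4]. *)
Lemma ln_root_product_dist (M : R) K (s t : seq R) : 0 < M ->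
  {in s, forall a, 0 <= a <= M} -> {in t, forall a, 0 <= a <= M} ->
  size s = size t ->
  (forall k, (k <= K)%N -> (root_product s)`_k = (root_product t)`_k) ->
  `|ln (root_product s).[1] - ln (root_product t).[1]| <=
    (size s)%:R * (8 * joukowski_radius M ^+ K.+1 / (1 - joukowski_radius M) ^+ 2).
Proof.
move=> M0 hs ht est h; have [p sp hp] := ln_poly_approx K M0.
set e := _ / _ in hp.
have ge0 (u : seq R) : {in u, forall a, 0 <= a <= M} -> {in u, forall a, 0 <= a}.
  by move=> hu a /hu/andP[].
rewrite (ln_root_product1 (ge0 s hs)).2 (ln_root_product1 (ge0 t ht)).2.
have bound (u : seq R) : {in u, forall a, 0 <= a <= M} ->
    `|\sum_(a <- u) ln (1 + a) - \sum_(a <- u) p.[a]| <= (size u)%:R * e.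
  move=> hu; rewrite -sumrB; apply: le_trans (ler_norm_sum _ _ _) _.
  have -> : (size u)%:R * e = \sum_(a <- u) e.
    by rewrite big_const_seq count_predT iter_addr_0 mulr_natl.
  by rewrite big_seq [leRHS]big_seq; apply: ler_sum => a /hu/hp.
have E := horner_sum_eq est h sp.
have := bound s hs; have := bound t ht; rewrite E -est => b1 b2.
have -> : 8 * joukowski_radius M ^+ K.+1 / (1 - joukowski_radius M) ^+ 2 = e + e.
  by rewrite /e; ring.
rewrite mulrDr; apply: le_trans (lerD b2 b1).
rewrite [X in _ <= _ + X]distrC; apply: le_trans (ler_normD _ _).
by rewrite addrA subrK.
Qed.

(** With [D = sqrt d], the bound [s <= 3 D] gives [1 - r = 2 / (s + 1) >= 1 / (2 D)]. Thus
    [r <= exp (- 1 / (2 D))], and more than [16 D L] factors bring the power below [exp (- 8 L)]. *)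
Lemma joukowski_radius_bound (d : nat) K (L : R) : (0 < d)%N -> 0 <= L ->
  16 * Num.sqrt d%:R * L < K.+1%:R ->
  joukowski_radius (4 * d%:R) ^+ K.+1 / (1 - joukowski_radius (4 * d%:R)) ^+ 2 <=
  expR (- L) ^+ 8 * (4 * d%:R).
Proof.
move=> d0 L0 ltK; rewrite /joukowski_radius.
set s := Num.sqrt (1 + _); set r := (s - 1) / (s + 1).
set D := Num.sqrt d%:R in ltK.
have d1 : 1 <= d%:R :> R by rewrite ler1n.
have D2 : D ^+ 2 = d%:R by rewrite sqr_sqrtr.
have D0 : 0 <= D by apply: sqrtr_ge0.
have s0 : 0 <= s by apply: sqrtr_ge0.
have s2 : s ^+ 2 = 1 + 4 * d%:R by rewrite sqr_sqrtr //; lra.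
have D1 : 1 <= D by rewrite -(ler_pXn2r (ltn0Sn 1)) ?nnegrE // expr1n D2.
have sD : s <= 3 * D.
  by rewrite -(ler_pXn2r (ltn0Sn 1)) ?nnegrE ?mulr_ge0 // exprMn D2 s2; lra.
have s1 : 1 <= s by rewrite -(ler_pXn2r (ltn0Sn 1)) ?nnegrE // expr1n s2; lra.
have sp : 0 < s + 1 by lra.
have Dp : 0 < D by lra.
have r0 : 0 <= r by rewrite divr_ge0 ?subr_ge0 // ltW.
have r1E : 1 - r = 2 / (s + 1) by rewrite /r; field; rewrite gt_eqF.
have r1 : (2 * D)^-1 <= 1 - r.
  rewrite r1E ler_pdivlMr // mulrC ler_pdivrMr ?mulr_gt0 //; lra.
have i2D : 0 < (2 * D)^-1 by rewrite invr_gt0 mulr_gt0.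
apply: ler_pM; rewrite ?exprn_ge0 ?invr_ge0 ?exprn_ge0 //; try lra.
  have rexp : r <= expR (- (2 * D)^-1).
    by apply: le_trans (expR_ge1Dx _); lra.
  apply: le_trans (lerXn2r _ _ _ rexp) _; rewrite ?nnegrE ?expR_ge0 //.
  rewrite -!expRM_natl ler_expR !mulrN lerN2.
  rewrite ler_pdivlMr ?mulr_gt0 //; apply: le_trans (ltW ltK); lra.
have -> : 4 * d%:R = (((2 * D)^-1) ^+ 2)^-1 by rewrite exprVn invrK exprMn D2; lra.
by rewrite lef_pV2 ?posrE ?exprn_gt0 //; [rewrite lerXn2r ?nnegrE //; lra | lra].
Qed.

End Truncation.

(** * Comparison of two graphs with the same small counts *)

Lemma degree_le_max (G : sgraph) (u : vertex G) : (degree u <= max_degree G)%N.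
Proof. exact: leq_bigmax. Qed.

Lemma max_degree_ltn (G : sgraph) : (0 < num_vertices G)%N ->
  (max_degree G < num_vertices G)%N.
Proof.
move=> v0; rewrite -(prednK v0) ltnS; apply/bigmax_leqP => u _.
rewrite -ltnS (prednK v0) /num_vertices -cardsT; apply: proper_card.
apply/properP; split; first exact: subsetT.
by exists u; rewrite ?inE // adj_irr.
Qed.

(** Settles [Delta = 0], which the factorisation excludes: the count then depends only on the number
    of vertices. *)
Lemma num_indep_edgeless (G : sgraph) : max_degree G = 0%N ->
  num_indep G = (2 ^ num_vertices G)%N.
Proof.
move=> m0; rewrite /num_indep /num_vertices -cardsT -card_powerset powersetT.
apply: eq_card => A; rewrite !inE; apply/independentP => u w _ _.
have := degree_le_max u; rewrite m0 leqn0 cards_eq0 => /eqP/setP/(_ w).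
by rewrite !inE => ->.
Qed.

Lemma num_indep_gt0 (G : sgraph) : (0 < num_indep G)%N.
Proof.
by apply/card_gt0P; exists set0; rewrite inE independent0.
Qed.

Lemma ln_num_indep_dist (R : realType) (G H : sgraph) (eps : R) :
  let v := num_vertices G in let Delta := max_degree G in
  let K := Num.truncn (16 * Num.sqrt (Delta%:R) * ln (v%:R / eps)) in
  claw_free G -> claw_free H -> num_vertices H = v -> max_degree H = Delta ->
  (0 < v)%N -> 0 < eps -> eps < 1 ->
  (forall k, (k <= K)%N -> num_indep_k G k = num_indep_k H k) ->
  `|ln (num_indep G)%:R - ln (num_indep H)%:R| <= eps.
Proof.
move=> v Delta K cG cH vH dH v0 e0 e1 h.
have [d0|d0] := posnP Delta.
  by rewrite !num_indep_edgeless ?dH // vH subrr normr0 ltW.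
have ltd : (Delta < v)%N by apply: max_degree_ltn.
(* Positive [Delta] forces two vertices, which makes [u = eps / v] at most 1/2. *)
have v2 : 2 <= v%:R :> R by rewrite ler_nat (leq_trans _ ltd).
pose L := ln (v%:R / eps); set u := eps / v%:R.
have vp : 0 < v%:R :> R by rewrite ltr0n.
have L0 : 0 <= L.
  by apply: ln_ge0; rewrite ler_pdivlMr // mul1r; lra.
have uE : expR (- L) = u.
  by rewrite expRN lnK ?posrE ?divr_gt0 // invf_div.
have ltK : 16 * Num.sqrt Delta%:R * L < K.+1%:R.
  by apply: truncnS_gt; rewrite !mulr_ge0 // sqrtr_ge0.
have degH w : (degree (w : vertex H) <= Delta)%N by rewrite -dH degree_le_max.
have [s [ss hs sE]] := indep_poly_factor R cG (@degree_le_max G) d0.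
have [t [st ht tE]] := indep_poly_factor R cH degH d0.
have M0 : 0 < 4 * Delta%:R :> R by rewrite mulr_gt0 ?ltr0n.
have hst k : (k <= K)%N -> (root_product s)`_k = (root_product t)`_k.
  by move=> /h e; rewrite /root_product -sE -tE !coef_indep_poly e.
have := ln_root_product_dist M0 hs ht _ hst.
rewrite ss st vH => /(_ erefl).
rewrite /root_product -sE -tE !indep_poly1 => /le_trans; apply.
have := joukowski_radius_bound d0 L0 ltK; rewrite uE.
set x := _ / _ => hx.
have u0 : 0 <= u by rewrite divr_ge0 // ltW.
have u1 : u <= 2^-1 by rewrite ler_pdivrMr //; lra.
have vu : v%:R * u = eps by rewrite mulrC divfK // gt_eqF.
have dv : Delta%:R <= v%:R :> R by rewrite ler_nat ltnW.
have -> : 8 * joukowski_radius (4 * Delta%:R) ^+ K.+1 /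
    (1 - joukowski_radius (4 * Delta%:R)) ^+ 2 = 8 * x.
  by rewrite /x; ring.
have u6 : u ^+ 6 <= 2^-1 ^+ 6 by rewrite lerXn2r ?nnegrE ?invr_ge0.
have u60 : 0 <= u ^+ 6 by rewrite exprn_ge0.
(* Of the eight factors [u], one absorbs [v] and one absorbs [Delta <= v], leaving [eps ^ 2]; the
   other six are at most 1/2 each, and [32 / 2 ^ 6 = 1/2]. *)
apply: (@le_trans _ _ (32 * eps ^+ 2 * u ^+ 6)).
  have -> : 32 * eps ^+ 2 * u ^+ 6 = v%:R * (8 * (u ^+ 8 * (4 * v%:R))) by rewrite -vu; ring.
  rewrite ler_pM2l // ler_pM2l //; apply: le_trans hx _.
  by rewrite ler_wpM2l ?exprn_ge0 // ler_pM2l.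
have e2 : eps ^+ 2 <= eps by rewrite expr2 ler_piMr // ltW.
apply: (@le_trans _ _ (32 * eps * 2^-1 ^+ 6)); last lra.
apply: ler_pM => //; first by rewrite mulr_ge0 // exprn_ge0 // ltW.
by rewrite ler_pM2l.
Qed.

Lemma approximates_nat (R : realType) (eps : R) (m n : nat) :
  (0 < m)%N -> (0 < n)%N -> `|ln m%:R - ln n%:R| <= eps ->
  approximates eps (m%:R : R[i]) n%:R.
Proof.
move=> m0 n0 le_eps; exists (ln n%:R)%:C, (ln m%:R)%:C.
have lnC (k : nat) : (0 < k)%N -> k%:R = cexp (ln k%:R : R)%:C.
  move=> k0; rewrite /cexp /= cos0 sin0 mulr1 mulr0 lnK ?posrE ?ltr0n //.
  by rewrite -[RHS]/((k%:R : R)%:C) rmorph_nat.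
split; [exact: lnC|exact: lnC|].
rewrite -rmorphB /= normc_def /= expr0n addr0 sqrtr_sqr lecR.
by rewrite distrC.
Qed.

Theorem theorem1p3 (R : realType) :
  exists2 c : R, 0 < c &
    forall (v Delta : nat) (eps : R),
      (1 <= v)%N -> 0 < eps -> eps < 1 ->
      let K := Num.truncn (c * Num.sqrt (Delta%:R) * ln (v%:R / eps)) in
      exists2 Phi : K.+1.-tuple nat -> R[i],
        (forall t, Phi t != 0) &
        forall G : sgraph,
          claw_free G -> num_vertices G = v -> max_degree G = Delta ->
          approximates eps (Phi [tuple num_indep_k G k | k < K.+1])
                       (num_indep G)%:R.
Proof.
(* [16 = 2 * 8]: the decay rate is [1 / (2 sqrt Delta)], and eight powers of [eps / v] are
   wanted. *)
exists 16 => // v Delta eps v0 e0 e1 K.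
pose realizes (G : sgraph) (t : K.+1.-tuple nat) :=
  [/\ claw_free G, num_vertices G = v, max_degree G = Delta &
      t = [tuple num_indep_k G k | k < K.+1]].
have pick t : exists n, (0 < n)%N /\ forall G, realizes G t ->
    exists2 H, realizes H t & n = num_indep H.
  (* A tuple that no graph realizes gets the value 1, which keeps [Phi] nonzero. *)
  have [[H rH]|nH] := pselect (exists H, realizes H t).
    by exists (num_indep H); split; [exact: num_indep_gt0|exists H].
  by exists 1%N; split=> // G rG; case: nH; exists G.
have [phi phiP] := choice pick.
exists (fun t => (phi t)%:R) => [t|G cG vG dG].
  by rewrite pnatr_eq0 -lt0n; case: (phiP t).
set t := [tuple _ | _ < _]; have [phi0 /(_ G)[] // H [cH vH dH tE] phiE] := phiP t.
rewrite phiE; apply: approximates_nat; rewrite ?num_indep_gt0 //.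
apply: ln_num_indep_dist; rewrite ?vH ?dH // => k lek.
have := congr1 (fun u : K.+1.-tuple nat => tnth u (Ordinal (lek : (k < K.+1)%N))) tE.
by rewrite !tnth_mktuple.
Qed.
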